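(* Let $V > 0$ and $\sigma > 0$. Let $G_0, G_1$ be probability distributions on $\mathbb{R}$, each with mean zero and with variance at most $V$. Then $$ \mathbb{E}_{G_0}\left[\left(\mathbb{E}_{G_1}[\theta \mid X]\right)^2\right] \le 6V + 4\sigma^2 . $$
   Context: For $\theta \in \mathbb{R}$ and $\sigma>0$, let $f_X(x \mid \theta) = \frac{1}{\sqrt{2\pi}\,\sigma} \exp\left(-\frac{(x-\theta)^2}{2\sigma^2}\right)$ be the density of the likelihood $X \mid \theta \sim N(\theta, \sigma^2)$. For a probability distribution (prior) $G$ on $\mathbb{R}$, $\mathbb{E}_{G}[\theta \mid X]$ denotes the posterior mean of $\theta$ under prior $\theta \sim G$ and likelihood $X\mid\theta \sim N(\theta,\sigma^2)$, that is, the function of the data given by $$\mathbb{E}_{G}[\theta \mid X = x] = \frac{\int \theta f_X(x\mid\theta)\,G(d\theta)}{\int f_X(x\mid\theta)\,G(d\theta)}, \quad x \in \mathbb{R}.$$ The outer expectation $\mathbb{E}_{G_0}[\cdot]$ is taken with $\theta \sim G_0$ and $X \mid \theta \sim N(\theta, \sigma^2)$, so that $X$ has marginal law $N(0,\sigma^2) \star G_0$ (convolution). Thus the quantity in the claim is the squared $L^2$-norm of the function $x \mapsto \mathbb{E}_{G_1}[\theta \mid X = x]$ under the law $N(0,\sigma^2)\star G_0$. *)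

(* Defs.v *)
From HB Require Import structures.
From mathcomp Require Import all_boot all_order all_algebra.
From mathcomp Require Import all_classical all_reals all_analysis.
From mathcomp Require Import measurable_realfun.

Set Implicit Arguments.
Unset Strict Implicit.
Unset Printing Implicit Defensive.

Import Order.TTheory GRing.Theory Num.Theory.
Import numFieldNormedType.Exports.

Local Open Scope classical_set_scope.
Local Open Scope ring_scope.

(* In [normal_pdf t sigma x] the arguments are the mean, the standard deviation
   (not the variance) and the point; for [sigma] nonzero this is the N(t, sigma^2)
   density at [x]. *)
Definition posterior_mean {R : realType} (sigma : R)
    (G : probability (measurableTypeR R) R) (x : R) : R :=
  (\int[G]_t (t * normal_pdf t sigma x)) / (\int[G]_t normal_pdf t sigma x).

(* Law of the pair (theta, X) with theta ~ G and X | theta ~ N(theta, sigma^2):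
   a set A has mass \int G(dt) N(t, sigma^2)({x | (t, x) \in A}). *)
Definition normal_model {R : realType} (sigma : R)
    (G : probability (measurableTypeR R) R) :
    set (measurableTypeR R * measurableTypeR R) -> \bar R :=
  fun A => (\int[G]_t normal_prob t sigma (xsection A t))%E.

Section normal_model_is_probability.
Context {R : realType} (sigma : R) (G : probability (measurableTypeR R) R).
Local Open Scope ereal_scope.
Local Notation T := (measurableTypeR R).

Let measurable_joint_pdf :
  measurable_fun [set: T * T] (fun p : T * T => normal_pdf p.1 sigma p.2).
Proof.
rewrite /normal_pdf; have [_|s0] := eqVneq sigma 0%R.
  by apply: measurableT_comp => //; exact: measurable_indic.
apply: measurable_funM => //; apply: measurableT_comp => //=.
apply: measurable_funM => //=; apply: measurableT_comp => //=.
by apply: measurable_funX => //=; exact: measurable_funB.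
Qed.

Lemma measurable_normal_prob_xsection (A : set (T * T)) : measurable A ->
  measurable_fun [set: T] (fun t => normal_prob t sigma (xsection A t)).
Proof.
move=> mA.
have -> : (fun t => normal_prob t sigma (xsection A t)) =
  fubini_F lebesgue_measure
    (fun p : T * T => (normal_pdf p.1 sigma p.2 * \1_A p)%:E).
  apply/funext => t; rewrite /normal_prob /fubini_F [LHS]integral_mkcond.
  apply: eq_integral => x _; rewrite /= patchE indicE mem_xsection.
  by case: ifP => _; rewrite ?mulr1 ?mulr0.
apply: measurable_fun_fubini_tonelli_F.
- by apply/measurable_EFinP; apply: measurable_funM => //;
    exact: measurable_indic.
- by move=> p; rewrite lee_fin mulr_ge0// normal_pdf_ge0.
Qed.

Let normal_model0 : normal_model sigma G set0 = 0.
Proof. by apply: integral0_eq => t _; rewrite xsection0 measure0. Qed.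

Let normal_model_ge0 A : 0 <= normal_model sigma G A.
Proof. exact: integral_ge0. Qed.

Let normal_model_sigma_additive : semi_sigma_additive (normal_model sigma G).
Proof.
move=> F mF tF mUF.
have -> : normal_model sigma G (\bigcup_n F n) =
    \sum_(0 <= n <oo) normal_model sigma G (F n).
  rewrite /normal_model -integral_nneseries//; last first.
    by move=> n; exact: measurable_normal_prob_xsection.
  apply: eq_integral => t _; rewrite xsection_bigcup measure_bigcup//.
  - by apply: eq_eseriesl => n; rewrite in_setT.
  - by move=> n _; exact: measurable_xsection.
  - exact: trivIset_xsection.
by apply: is_cvg_ereal_nneg_natsum_cond => n _ _; exact: normal_model_ge0.
Qed.

HB.instance Definition _ := isMeasure.Build _ _ _ (normal_model sigma G)
  normal_model0 normal_model_ge0 normal_model_sigma_additive.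

Let normal_model_setT : normal_model sigma G [set: _] = 1.
Proof.
rewrite /normal_model.
under eq_integral do rewrite xsectionE preimage_setT probability_setT.
by rewrite integral_cst// mul1e; exact: probability_setT.
Qed.

HB.instance Definition _ :=
  Measure_isProbability.Build _ _ _ (normal_model sigma G) normal_model_setT.

End normal_model_is_probability.

(* Main.v *)
Require Import Defs.
From mathcomp Require Import all_boot all_order all_algebra.
From mathcomp Require Import all_classical all_reals all_analysis.
From mathcomp Require Import measurable_realfun ring lra.

Import Order.TTheory GRing.Theory Num.Theory.
Import numFieldNormedType.Exports.

Local Open Scope classical_set_scope.
Local Open Scope ring_scope.

(* Under G1, the likelihood at x is a decreasing function of (theta - x)^2, so the
   posterior second moment of theta around x is at most its prior value, which is
   at most V + x^2. As theta^2 <= 2 x^2 + 2 (theta - x)^2, Jensen's inequality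
   bounds the squared posterior mean at x by 4 x^2 + 2 V. Integrating against the
   law of X under G0, where E X^2 <= V + sigma^2, gives 6 V + 4 sigma^2.
   The second moment of N(t, sigma^2) is obtained by exponential tilting: the
   integrals of e^(a(x - t)) are known from the total mass of the translated
   densities, and a tends to 0 in the bounds of z^2 and z by exponentials. *)

(** * Elementary bounds on the exponential *)

Lemma expR_ge1DxD2 (R : realType) (v : R) :
  0 <= v -> 1 + v + v ^+ 2 / 2 <= expR v.
Proof.
move=> v0; rewrite /expR.
have -> : 1 + v + v ^+ 2 / 2 = series (exp_coeff v) 3.
  rewrite /series/= !big_nat_recr//= big_nil /exp_coeff/=.
  by rewrite !factS fact0 expr0 expr1 !muln1 divr1 invr1 !mulr1 add0r.
apply: nondecreasing_cvgn_le; last exact: is_cvg_series_exp_coeff.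
by apply: nondecreasing_series => n _ _; rewrite /exp_coeff/= divr_ge0// exprn_ge0.
Qed.

(** With [v = y / 2] the claim reads [(e^v - e^(-v))^2 >= (2v)^2], so for [v >= 0] it suffices that
    [e^v - e^(-v) >= 2v]. *)
Lemma expRDexpRN_ge (R : realType) (y : R) : 2 + y ^+ 2 <= expR y + expR (- y).
Proof.
wlog y0 : y / 0 <= y => [hwlog|].
  have [/hwlog//|y0] := leP 0 y.
  by have := hwlog (- y); rewrite opprK sqrrN [expR (- y) + _]addrC; apply; rewrite oppr_ge0 ltW.
have -> : y = y / 2 + y / 2 by field.
have v0 : 0 <= y / 2 by rewrite divr_ge0.
rewrite opprD !expRD; move: (y / 2) v0 => v v0.
have := @expR_ge1DxD2 _ _ v0; have := expRxMexpNx_1 v; have := expR_ge0 (- v).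
move: (expR v) (expR (- v)) => a b b0 ab ca.
have vv : 0 <= v ^+ 2 by rewrite sqr_ge0.
(* The reciprocal of the lower bound for [e^v] is at most [1 - v + v^2 / 2], because the product of
   the two polynomials is [1 + v^4 / 4 >= 1]. *)
have bv : b <= 1 - v + v ^+ 2 / 2.
  have h : (1 + v + v ^+ 2 / 2) * b <= 1 by rewrite -[leRHS]ab ler_wpM2r.
  have c0 : 0 < 1 + v + v ^+ 2 / 2 by lra.
  rewrite -(ler_pM2l c0); apply: (le_trans h).
  have -> : (1 + v + v ^+ 2 / 2) * (1 - v + v ^+ 2 / 2) = 1 + (v ^+ 2) ^+ 2 / 4.
    by field.
  by rewrite lerDl divr_ge0// sqr_ge0.
have : 2 * v <= a - b by lra.
nra.
Qed.

(** From [e^(-w) >= 1 - w] follows [e^w <= 1 / (1 - w)], and [(1 - w)(1 + w + 2w^2) = 1 + w^2 (1 -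
    2w) >= 1] for [w <= 1/2]. *)
Lemma expR_sub1_le (R : realType) (w : R) :
  0 <= w -> w <= 1 / 2 -> expR w - 1 <= w + 2 * w ^+ 2.
Proof.
move=> w0 w1; have := expR_ge1Dx (- w); have := expRxMexpNx_1 w.
have := expR_ge0 w; move: (expR w) (expR (- w)) => a b a0 ab bw.
have h : a * (1 - w) <= 1 by rewrite -[leRHS]ab ler_wpM2l//; lra.
have : 0 <= w ^+ 2 by rewrite sqr_ge0.
have c0 : 0 < 1 - w by lra.
move=> ww; rewrite lerBlDr -(ler_pM2r c0); apply: (le_trans h).
nra.
Qed.

(** * Second moment of the normal law *)

(** Completing the square in the exponent: the tilt by [a] moves the mean by [a * s ^+ 2] and leaves
    a constant factor. *)
Lemma normal_pdf_tilt (R : realType) (t s a x : R) : s != 0 ->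
  normal_pdf t s x * expR (a * (x - t)) =
  expR (a ^+ 2 * s ^+ 2 / 2) * normal_pdf (t + a * s ^+ 2) s x.
Proof.
move=> s0; rewrite !normal_pdfE// /normal_fun -[LHS]mulrA [RHS]mulrCA -!expRD.
congr (_ * expR _).
by field.
Qed.

(* With [z = x - t], integrate [2 + (kz)^2 <= e^(kz) + e^(-kz)] and
   [1 + 2tkz <= e^(2tkz)]: after tilting, the right-hand sides are multiples of
   normal densities. Sides are arranged so that all terms are nonnegative. *)
Lemma normal_pdf_sqr_le (R : realType) (t s k x : R) : s != 0 -> 0 < k ->
  x ^+ 2 * normal_pdf t s x
  + (2 / k ^+ 2 + k^-1) * normal_pdf t s x <=
  t ^+ 2 * normal_pdf t s x
  + (expR (k ^+ 2 * s ^+ 2 / 2) / k ^+ 2) * normal_pdf (t + k * s ^+ 2) s x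
  + (expR (k ^+ 2 * s ^+ 2 / 2) / k ^+ 2) * normal_pdf (t - k * s ^+ 2) s x
  + (expR ((2 * t * k) ^+ 2 * s ^+ 2 / 2) / k) *
    normal_pdf (t + 2 * t * k * s ^+ 2) s x.
Proof.
move=> s0 k0.
have k00 : k != 0 by rewrite gt_eqF.
have E1 := @normal_pdf_tilt _ t s k x s0.
have := @normal_pdf_tilt _ t s (- k) x s0; rewrite sqrrN !mulNr => E2.
have E3 := @normal_pdf_tilt _ t s (2 * t * k) x s0.
rewrite ![expR (_ ^+ 2 * s ^+ 2 / 2) / _ * _]mulrAC -E1 -E2 -E3.
have H1 := expRDexpRN_ge _ (k * (x - t)).
have H2 := expR_ge1Dx (2 * t * k * (x - t)).
have p0 := normal_pdf_ge0 t s x.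
move: (normal_pdf t s x) p0 (expR (k * (x - t))) (expR (- (k * (x - t)))) H1
  (expR (2 * t * k * (x - t))) H2 => p p0 a b H1 c H2.
have -> : x ^+ 2 * p + (2 / k ^+ 2 + k^-1) * p =
  p * (t ^+ 2 + (2 + (k * (x - t)) ^+ 2) / k ^+ 2 + (1 + 2 * t * k * (x - t)) / k).
  by field.
have -> : t ^+ 2 * p + p * a / k ^+ 2 + p * b / k ^+ 2 + p * c / k =
  p * (t ^+ 2 + (a + b) / k ^+ 2 + c / k) by field.
apply: ler_wpM2l => //; rewrite -[leLHS]addrA -[leRHS]addrA lerD2l.
apply: lerD; apply: ler_wpM2r => //; rewrite invr_ge0 ltW//.
exact: exprn_gt0.
Qed.

(** Each added density has mass 1. Iteration gives the integrability and the integral of the upper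
    bound in [normal_pdf_sqr_le]. *)
Lemma integral_addZ_normal_pdf (R : realType) (f : R -> R) (r a t s : R) :
  lebesgue_measure.-integrable setT (EFin \o f) ->
  (\int[lebesgue_measure]_x (f x)%:E = r%:E)%E ->
  lebesgue_measure.-integrable setT
    (fun x => (f x + a * normal_pdf t s x)%:E) /\
  (\int[lebesgue_measure]_x (f x + a * normal_pdf t s x)%:E = (r + a)%:E)%E.
Proof.
move=> intf intfE.
have intp : lebesgue_measure.-integrable setT
    (fun x => (a%:E * (normal_pdf t s x)%:E)%E).
  by apply: integrableZl => //; exact: integrable_normal_pdf.
split; first by under eq_fun do rewrite EFinD EFinM; exact: integrableD.
rewrite (_ : (fun x => _) = (fun x => (f x)%:E + a%:E * (normal_pdf t s x)%:E)%E).
  rewrite integralD// intfE integralZl//; last exact: integrable_normal_pdf.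
  by rewrite integral_normal_pdf mule1.
by apply/funext => x; rewrite EFinD EFinM.
Qed.

Lemma normal_second_moment_tilt (R : realType) (t s k : R) : s != 0 -> 0 < k ->
  (\int[lebesgue_measure]_x (x ^+ 2 * normal_pdf t s x)%:E <=
   (t ^+ 2 + 2 * (expR (k ^+ 2 * s ^+ 2 / 2) - 1) / k ^+ 2
     + (expR ((2 * t * k) ^+ 2 * s ^+ 2 / 2) - 1) / k)%:E)%E.
Proof.
move=> s0 k0.
set mu := lebesgue_measure.
set c := expR (k ^+ 2 * s ^+ 2 / 2).
set d := expR ((2 * t * k) ^+ 2 * s ^+ 2 / 2).
have mp m : measurable_fun [set: R] (normal_pdf m s) := measurable_normal_pdf m s.
have mx2p : measurable_fun [set: R] (fun x => (x ^+ 2 * normal_pdf t s x)%:E).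
  apply/measurable_EFinP; apply: measurable_funM; last exact: mp.
  exact: measurable_funX.
have q0 : 0 <= 2 / k ^+ 2 + k^-1.
  by rewrite addr_ge0// ?divr_ge0// ?invr_ge0 ?exprn_ge0// ltW.
have [i0 e0] : mu.-integrable setT (EFin \o (fun=> 0)) /\
    (\int[mu]_x (0 : R)%:E = 0%:E :> \bar R)%E.
  by split; [exact: integrable0|rewrite integral0].
have [i1 e1] := @integral_addZ_normal_pdf R _ 0 (t ^+ 2) t s i0 e0.
have [i2 e2] := @integral_addZ_normal_pdf R _ _ (c / k ^+ 2) (t + k * s ^+ 2) s i1 e1.
have [i3 e3] := @integral_addZ_normal_pdf R _ _ (c / k ^+ 2) (t - k * s ^+ 2) s i2 e2.
have [i4 e4] := @integral_addZ_normal_pdf R _ _ (d / k) (t + 2 * t * k * s ^+ 2) s i3 e3.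
(* The term [2 / k ^+ 2 + k^-1] stays on the left until after integration, so that both sides are
   integrals of nonnegative functions and the second moment may a priori be infinite. *)
have : (\int[mu]_x (x ^+ 2 * normal_pdf t s x)%:E + (2 / k ^+ 2 + k^-1)%:E <=
    (0 + t ^+ 2 + c / k ^+ 2 + c / k ^+ 2 + d / k)%:E)%E.
  rewrite -e4 -[X in (_ + X)%E]mule1 -(integral_normal_pdf t s).
  rewrite -ge0_integralZl//; last 2 first.
  - apply/measurable_EFinP; exact: mp.
  - by move=> x _; rewrite lee_fin normal_pdf_ge0.
  rewrite -ge0_integralD//; last 3 first.
  - by move=> x _; rewrite lee_fin mulr_ge0 ?sqr_ge0 ?normal_pdf_ge0.
  - by move=> x _; rewrite mule_ge0// lee_fin normal_pdf_ge0.
  - by apply: measurable_funeM; apply/measurable_EFinP; exact: mp.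
  apply: ge0_le_integral => //.
  - move=> x _; rewrite -EFinM -EFinD lee_fin.
    by rewrite addr_ge0// mulr_ge0 ?sqr_ge0 ?normal_pdf_ge0.
  - apply: emeasurable_funD.
      exact: mx2p.
    by apply: measurable_funeM; apply/measurable_EFinP; exact: mp.
  - by move/integrableP : i4 => [].
  - move=> x _; rewrite -EFinM -EFinD lee_fin add0r.
    exact: normal_pdf_sqr_le.
rewrite -leeBrDr// -EFinB => /le_trans; apply; rewrite lee_fin.
by rewrite le_eqVlt; apply/orP; left; apply/eqP; field; rewrite gt_eqF.
Qed.

Lemma normal_second_moment_le (R : realType) (t s : R) : s != 0 ->
  (\int[lebesgue_measure]_x (x ^+ 2 * normal_pdf t s x)%:E <=
   (t ^+ 2 + s ^+ 2)%:E)%E.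
Proof.
move=> s0; apply/lee_addgt0Pr => e e0.
set T := t ^+ 2; set S := s ^+ 2.
have T0 : 0 <= T by exact: sqr_ge0.
have S0 : 0 <= S by exact: sqr_ge0.
have TS0 : 0 <= T * S by exact: mulr_ge0.
have SS0 : 0 <= S * S by exact: mulr_ge0.
(* The final error is at most [k * (S * S) + 4 * (k * (T * S))], which is at most [k * K = m <= e].
   As [m <= 1], the terms [1], [S] and [4 * (T * S)] also give [k <= 1] and make both exponents at
   most 1/2. *)
pose K := 1 + S + 4 * (T * S) + S * S.
have K0 : 0 < K by rewrite /K; lra.
pose m := Num.min 1 e.
have m0 : 0 < m by rewrite lt_min ltr01.
have m1 : m <= 1 by rewrite ge_min lexx.
have me : m <= e by rewrite ge_min lexx orbT.
pose k := m / K.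
have k0 : 0 < k by rewrite divr_gt0.
have kK : k * K = m by rewrite /k divfK// gt_eqF.
have kS0 : 0 <= k * S by rewrite mulr_ge0// ltW.
have kTS0 : 0 <= k * (T * S) by rewrite mulr_ge0// ltW.
have kSS0 : 0 <= k * (S * S) by rewrite mulr_ge0// ltW.
have kE : k + k * S + 4 * (k * (T * S)) + k * (S * S) = m by rewrite -kK /K; ring.
have k1 : k <= 1 by lra.
apply: (le_trans (normal_second_moment_tilt _ t _ _ s0 k0)).
rewrite -EFinD lee_fin.
have kk : k ^+ 2 <= k by rewrite expr2 ler_piMr// ltW.
have k2 : 0 < k ^+ 2 by rewrite exprn_gt0.
have wc : 0 <= k ^+ 2 * S / 2 <= 1 / 2.
  have kkS0 : 0 <= k ^+ 2 * S by rewrite mulr_ge0// ltW.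
  by have ? := ler_wpM2r S0 kk; apply/andP; split; lra.
have wd : 0 <= (2 * t * k) ^+ 2 * S / 2 <= 1 / 2.
  have -> : (2 * t * k) ^+ 2 * S / 2 = 2 * (k ^+ 2 * (T * S)) by rewrite /T; field.
  have kkTS0 : 0 <= k ^+ 2 * (T * S) by rewrite mulr_ge0// ltW.
  by have ? := ler_wpM2r TS0 kk; apply/andP; split; lra.
have [wc0 wc1] := andP wc; have [wd0 wd1] := andP wd.
have Hc := @expR_sub1_le _ _ wc0 wc1.
have Hd := @expR_sub1_le _ _ wd0 wd1.
have Ec : 2 * (expR (k ^+ 2 * S / 2) - 1) / k ^+ 2 <= S + k * (S * S).
  rewrite ler_pdivrMr//.
  have : 0 <= (k - k ^+ 2) * (S * S) * k ^+ 2.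
    apply: mulr_ge0; last exact: ltW.
    by apply: mulr_ge0 => //; rewrite subr_ge0.
  by nra.
(* For an exponent [w <= 1/2], [w + 2w^2 <= 2w]; here [w = 2 k^2 T S]. *)
have Ed : (expR ((2 * t * k) ^+ 2 * S / 2) - 1) / k <= 4 * (k * (T * S)).
  rewrite ler_pdivrMr//.
  move: Hd wd0 wd1.
  have -> : (2 * t * k) ^+ 2 * S / 2 = 2 * (k ^+ 2 * (T * S)) by rewrite /T; field.
  have -> : 4 * (k * (T * S)) * k = 4 * (k ^+ 2 * (T * S)) by ring.
  by move: (k ^+ 2 * (T * S)) => b; move: (expR _) => a; nra.
by rewrite -/T -/S; lra.
Qed.

(** * Pointwise bound on the posterior mean *)

Lemma measurable_normal_pdf_pair (R : realType) (s : R) : s != 0 ->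
  measurable_fun [set: measurableTypeR R * measurableTypeR R]
    (fun p : measurableTypeR R * measurableTypeR R => normal_pdf p.1 s p.2).
Proof.
move=> s0; under eq_fun do rewrite normal_pdfE//.
apply: measurable_funM => //; apply: measurableT_comp => //=.
apply: measurable_funM => //=; apply: measurableT_comp => //=.
by apply: measurable_funX => //=; exact: measurable_funB.
Qed.

Lemma integral_sqr_le_variance (R : realType) (V : R)
    (G : probability (measurableTypeR R) R) :
  ('E_G[@idfun R] = 0 -> 'V_G[@idfun R] <= V%:E ->
   \int[G]_t (t ^+ 2)%:E <= V%:E)%E.
Proof.
move=> mean0; rewrite /variance unlock mean0 unlock; congr (_ <= _)%E.
by apply: eq_integral => t _; rewrite !fctE/= subr0 expr2.
Qed.

Lemma measurable_normal_pdf_mean (R : realType) (s x : R) : s != 0 ->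
  measurable_fun [set: measurableTypeR R] (fun t => normal_pdf t s x).
Proof.
move=> s0; exact: (measurableT_comp (@measurable_normal_pdf_pair R s s0)
  (@pair2_measurable _ _ (measurableTypeR R) (measurableTypeR R) x)).
Qed.

Lemma normal_pdf_anti (R : realType) (s t u x : R) : s != 0 ->
  (t - x) ^+ 2 <= (u - x) ^+ 2 -> normal_pdf u s x <= normal_pdf t s x.
Proof.
move=> s0; rewrite !normal_pdfE// /normal_fun => tu.
apply: ler_wpM2l; first exact: normal_peak_ge0.
rewrite ler_expR !mulNr lerN2 ler_wpM2r ?invr_ge0 ?mulrn_wge0 ?sqr_ge0//.
by rewrite -(opprB t) -(opprB u) !sqrrN.
Qed.

(** Jensen's and Chebyshev's inequalities both enter as pointwise inequalities in [t], so a single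
    integration against [G] yields the bound. *)
Lemma posterior_mean_sqr_le (R : realType) (V s x : R)
    (G : probability (measurableTypeR R) R) : s != 0 ->
  (\int[G]_t (t ^+ 2)%:E <= V%:E)%E -> \int[G]_t t = 0 ->
  posterior_mean s G x ^+ 2 <= 4 * x ^+ 2 + 2 * V.
Proof.
move=> s0 intV mean0.
pose p t := normal_pdf t s x.
have mp : measurable_fun [set: measurableTypeR R] p.
  exact: measurable_normal_pdf_mean.
have p0 t : 0 <= p t by exact: normal_pdf_ge0.
have pb : [bounded p t | t in [set: measurableTypeR R]].
  exists (normal_peak s); split; first exact: num_real.
  move=> M sM t _ /=; rewrite ger0_norm// (le_trans _ (ltW sM))//.
  exact: normal_pdf_ub.
have i1 c : G.-integrable setT (EFin \o cst c).
  exact: finite_measure_integrable_cst.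
have ip : G.-integrable setT (EFin \o p).
  apply: measurable_bounded_integrable => //.
  by rewrite (le_lt_trans (probability_le1 _ _))// ltry.
have i2 : G.-integrable setT (EFin \o (fun t => t ^+ 2)).
  apply/integrableP; split.
    by apply/measurable_EFinP; exact: measurable_funX.
  under eq_integral do rewrite /= ger0_norm ?sqr_ge0//.
  by rewrite (le_lt_trans intV)// ltry.
have it : G.-integrable setT (EFin \o (fun t => t)).
  apply: (@le_integrable _ (measurableTypeR R) R G setT measurableT _
    (fun t => (1 + t ^+ 2)%:E)).
  - exact/measurable_EFinP.
  - move=> t _ /=; rewrite lee_fin [leRHS]ger0_norm; last first.
      by rewrite addr_ge0// sqr_ge0.
    rewrite -(normr_id t) -[t ^+ 2]real_normK ?num_real//.
    have := sqr_ge0 (`|t| - 1); rewrite normr_id; nra.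
  - have := integrableD measurableT (i1 1) i2.
    by apply: eq_integrable => // t _; rewrite /= EFinD.
have itp : G.-integrable setT (EFin \o (fun t => t * p t)).
  have := integrableMl measurableT it mp pb.
  by apply: eq_integrable => // t _; rewrite /= EFinM.
rewrite /posterior_mean.
set D := \int[G]_t p t.
set N := \int[G]_t (t * p t).
have D0 : 0 <= D by apply: Rintegral_ge0 => t _.
have V0 : 0 <= V.
  by rewrite -lee_fin (le_trans _ intV)// integral_ge0// => t _; rewrite lee_fin sqr_ge0.
have [DE|Dn0] := eqVneq D 0.
  (* [D = 0] cannot occur, but division by zero gives [0] and the bound holds. *)
  by rewrite DE invr0 mulr0 expr0n/= addr_ge0// mulr_ge0// sqr_ge0.
have {Dn0}D0 : 0 < D by rewrite lt_neqAle eq_sym Dn0.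
set m := N / D.
have Nm : N = m * D by rewrite /m divfK// gt_eqF.
pose S := \int[G]_t (t ^+ 2).
have SV : S <= V.
  by rewrite -lee_fin /S /Rintegral fineK//; exact: integrable_fin_num.
(* As the prior mean is zero, [U] is the prior second moment of theta around [x]; [c] below is the
   likelihood at distance [r] from [x]. *)
pose U := S + x ^+ 2.
pose r := Num.sqrt U.
have U0 : 0 <= U.
  by rewrite addr_ge0 ?sqr_ge0// Rintegral_ge0// => t _; exact: sqr_ge0.
pose c := p (x + r).
(* Chebyshev's association inequality in pointwise form: [p] decreases with
   [(t - x)^2], so [(t - x)^2 - U] and [p t - c] have opposite signs. *)
have cheb t : (t - x) ^+ 2 * p t <= U * p t + c * ((t - x) ^+ 2 - U).
  have rU : (x + r - x) ^+ 2 = U by rewrite addrC addKr sqr_sqrtr.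
  have [tU|Ut] := leP ((t - x) ^+ 2) U.
    have : c <= p t by apply: normal_pdf_anti => //; rewrite rU.
    by nra.
  have : p t <= c by apply: normal_pdf_anti => //; rewrite rU ltW.
  by nra.
(* After multiplication by [p t], [h1] is [2mt <= m^2 + t^2] (Jensen at the posterior mean [m]), and
   [h2] is [t^2 <= 2x^2 + 2(t - x)^2], whose last square [cheb] bounds. *)
have pt t : (2 * m) * (t * p t) <=
    (m ^+ 2 + 2 * x ^+ 2 + 2 * U) * p t + (2 * c) * t ^+ 2
    + (- (4 * c * x)) * t + 2 * c * (x ^+ 2 - U).
  have h1 : 0 <= (t - m) ^+ 2 * p t by rewrite mulr_ge0// sqr_ge0.
  have h2 : 0 <= (t - 2 * x) ^+ 2 * p t by rewrite mulr_ge0// sqr_ge0.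
  by have := cheb t; nra.
have iZ (k : R) f : G.-integrable setT (EFin \o f) ->
    G.-integrable setT (EFin \o (fun t => k * f t)).
  move=> /(integrableZl measurableT k).
  by apply: eq_integrable => // t _; rewrite /= EFinM.
have iD f g : G.-integrable setT (EFin \o f) -> G.-integrable setT (EFin \o g) ->
    G.-integrable setT (EFin \o (fun t => f t + g t)).
  move=> fi gi; have := integrableD measurableT fi gi.
  by apply: eq_integrable => // t _; rewrite /= EFinD.
have := @le_Rintegral _ _ _ G setT _ _ measurableT (iZ (2 * m) _ itp)
  (iD _ _ (iD _ _ (iD _ _ (iZ (m ^+ 2 + 2 * x ^+ 2 + 2 * U) _ ip)
    (iZ (2 * c) _ i2)) (iZ (- (4 * c * x)) _ it)) (i1 (2 * c * (x ^+ 2 - U))))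
  (fun t _ => pt t).
rewrite !RintegralD//; [|by auto..].
rewrite !RintegralZl//; last exact: i1.
rewrite Rintegral_cst// [X in fine X]probability_setT /= mulr1.
(* The terms in [c] integrate to [2c(S + x^2 - U) = 0]. There remains
   [2 m^2 D <= (m^2 + 2x^2 + 2U) D], that is, [m^2 <= 4x^2 + 2S]. *)
rewrite -/D -/N -/S mean0 Nm => h.
rewrite -(ler_pM2r D0); move: h; rewrite /U => h.
have : (S - V) * D <= 0 by rewrite mulr_le0_ge0 ?subr_le0// ltW.
nra.
Qed.

(** * Integration against the joint law of theta and X *)

Local Open Scope ereal_scope.

Section integral_density.
Import HBNNSimple.

(** On the fibres of a simple function the identity is the density hypothesis; linearity extends it
    to simple functions, and monotone convergence along [nnsfun_approx] to [f]. *)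
Lemma integral_density d (T : measurableType d) (R : realType)
    (mu nu : {measure set T -> \bar R}) (p : T -> R) (f : T -> \bar R) :
  measurable_fun setT p -> (forall x, (0 <= p x)%R) ->
  (forall A, measurable A -> nu A = \int[mu]_(x in A) (p x)%:E) ->
  measurable_fun setT f -> (forall x, 0 <= f x) ->
  \int[nu]_x f x = \int[mu]_x (f x * (p x)%:E).
Proof.
move=> mp p0 nuE mf f0.
have mpE : measurable_fun setT (EFin \o p) by exact/measurable_EFinP.
have nnsfunE (h : {nnsfun T >-> R}) :
    \int[nu]_x (h x)%:E = \int[mu]_x ((h x)%:E * (p x)%:E).
  rewrite integralT_nnsfun sintegralE.
  under [RHS]eq_integral.
    move=> x _; rewrite fimfunE -fsumEFin// ge0_mule_fsuml; last first.
      by move=> r; rewrite EFinM nnfun_muleindic_ge0.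
    over.
  rewrite ge0_integral_fsum//; last 2 first.
  - move=> r; apply: emeasurable_funM => //.
    by apply/measurable_EFinP/measurable_funM.
  - move=> r x _; apply: mule_ge0; rewrite ?lee_fin// -lee_fin EFinM.
    exact: nnfun_muleindic_ge0.
  apply: eq_fsbigr => r /[!inE] -[y _ <-{r}].
  under eq_integral do rewrite EFinM -muleA.
  rewrite ge0_integralZl//; last 3 first.
  - by apply: emeasurable_funM => //; exact/measurable_EFinP.
  - by move=> x _; rewrite mule_ge0 ?lee_fin.
  - by rewrite lee_fin.
  rewrite nuE//; congr *%E.
  rewrite integral_mkcond; apply: eq_integral => x _.
  rewrite patchE indicE; case: ifPn => _; by rewrite ?mul1e ?mul0e.
pose h := nnsfun_approx measurableT mf.
have hf x : (h n x)%:E @[n --> \oo] --> f x by exact: cvg_nnsfun_approx.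
have nd_h x : {homo (fun n => h n x) : m n / (m <= n)%N >-> (m <= n)%R}.
  by move=> m n mn; exact/lefP/nd_nnsfun_approx.
transitivity (limn (fun n => \int[nu]_x (h n x)%:E)).
  rewrite -monotone_convergence//.
  - by apply: eq_integral => x _; apply/esym/cvg_lim.
  - by move=> n; exact/measurable_EFinP.
  - by move=> n x _; rewrite lee_fin.
  - by move=> x _ m n mn; rewrite lee_fin nd_h.
under eq_fun do rewrite nnsfunE.
rewrite -monotone_convergence//.
- apply: eq_integral => x _; apply/cvg_lim => //.
  by apply: cvgeZr => //; exact: hf.
- by move=> n; apply: emeasurable_funM => //; exact/measurable_EFinP.
- by move=> n x _; rewrite mule_ge0 ?lee_fin.
- by move=> x _ m n mn; rewrite lee_wpmul2r// lee_fin// nd_h.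
Qed.

(* Both integrals are suprema over the simple functions below the integrand. *)
Lemma ge0_le_integral_nonmeasurable d (T : measurableType d) (R : realType)
    (mu : {measure set T -> \bar R}) (f g : T -> \bar R) :
  (forall x, 0 <= f x) -> (forall x, f x <= g x) ->
  \int[mu]_x f x <= \int[mu]_x g x.
Proof.
move=> f0 fg; have g0 x : 0 <= g x by exact: le_trans (fg x).
rewrite !ge0_integralTE//; apply: ereal_sup_le => _ [h hf <-].
exists h => // x.
exact: le_trans (fg x).
Qed.

End integral_density.

(** The joint law has density [normal_pdf z.1 s z.2] with respect to [G \x lebesgue_measure].
    Tonelli's theorem serves twice: to verify this on measurable sets and to iterate the
    integral. *)
Lemma integral_normal_model (R : realType) (s : R)
    (G : probability (measurableTypeR R) R)
    (f : measurableTypeR R * measurableTypeR R -> \bar R) : s != 0%R ->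
  measurable_fun setT f -> (forall z, 0 <= f z) ->
  \int[normal_model s G]_z f z =
  \int[G]_t \int[lebesgue_measure]_x (f (t, x) * (normal_pdf t s x)%:E).
Proof.
move=> s0 mf f0; have mp := @measurable_normal_pdf_pair R s s0.
have mpE : measurable_fun setT
    (fun z : measurableTypeR R * measurableTypeR R => (normal_pdf z.1 s z.2)%:E).
  exact/measurable_EFinP.
rewrite (@integral_density _ _ _ (G \x lebesgue_measure) _
  (fun z => normal_pdf z.1 s z.2))//.
- rewrite fubini_tonelli1//; first exact: emeasurable_funM.
  by move=> z; rewrite mule_ge0// lee_fin normal_pdf_ge0.
- by move=> z; exact: normal_pdf_ge0.
- move=> A mA; rewrite integral_mkcond fubini_tonelli1//; last 2 first.
  + apply/(measurable_restrictT _ _).1 => //; exact: measurable_funTS.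
  + by move=> z; rewrite erestrict_ge0// => {}z _; rewrite lee_fin normal_pdf_ge0.
  apply: eq_integral => t _; rewrite /normal_prob integral_mkcond.
  apply: eq_integral => x _; rewrite !patchE mem_xsection.
  by [].
Qed.

(** With [a = 4] and [b = 2 * V] this bounds the conditional expectation, given theta = [t], of the
    majorant of the squared posterior mean. *)
Lemma integral_affine_sqr_normal_pdf_le (R : realType) (a b t s : R) :
  (0 <= a)%R -> (0 <= b)%R -> s != 0%R ->
  \int[lebesgue_measure]_x ((a * x ^+ 2 + b)%:E * (normal_pdf t s x)%:E) <=
  (a * (t ^+ 2 + s ^+ 2) + b)%:E.
Proof.
move=> a0 b0 s0; under eq_integral do
  rewrite -EFinM mulrDl -mulrA EFinD (EFinM a) (EFinM b).
have a0' : 0 <= a%:E by rewrite lee_fin.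
have b0' : 0 <= b%:E by rewrite lee_fin.
have mp : measurable_fun [set: R] (normal_pdf t s) := measurable_normal_pdf t s.
have mpE : measurable_fun [set: R] (fun x => (normal_pdf t s x)%:E).
  exact/measurable_EFinP.
have mx2p : measurable_fun [set: R] (fun x => (x ^+ 2 * normal_pdf t s x)%:E).
  apply/measurable_EFinP; apply: measurable_funM; last exact: mp.
  exact: measurable_funX.
have p0 x : 0 <= (normal_pdf t s x)%:E by rewrite lee_fin normal_pdf_ge0.
have x2p0 x : 0 <= (x ^+ 2 * normal_pdf t s x)%:E.
  by rewrite lee_fin mulr_ge0 ?sqr_ge0 ?normal_pdf_ge0.
rewrite ge0_integralD//=; last 4 first.
- by move=> x _; exact: mule_ge0.
- exact: measurable_funeM.
- by move=> x _; exact: mule_ge0.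
- exact: measurable_funeM.
rewrite !ge0_integralZl//= integral_normal_pdf mule1 EFinD EFinM.
by rewrite leeD2r// lee_wpmul2l//; exact: normal_second_moment_le.
Qed.

Theorem lemma1 (R : realType) (V sigma : R)
    (G0 G1 : probability (measurableTypeR R) R)
    (V_gt0 : (0 < V)%R) (sigma_gt0 : (0 < sigma)%R)
    (mean_G0 : 'E_G0[@idfun R] = 0) (mean_G1 : 'E_G1[@idfun R] = 0)
    (var_G0 : 'V_G0[@idfun R] <= V%:E) (var_G1 : 'V_G1[@idfun R] <= V%:E) :
  'E_(normal_model sigma G0)[fun p => (posterior_mean sigma G1 p.2 ^+ 2)%R]
    <= (6 * V + 4 * sigma ^+ 2)%:E.
Proof.
have s0 : sigma != 0%R by rewrite gt_eqF.
have sqr_G0 := @integral_sqr_le_variance _ _ _ mean_G0 var_G0.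
have sqr_G1 := @integral_sqr_le_variance _ _ _ mean_G1 var_G1.
have {}mean_G1 : (\int[G1]_t t = 0)%R.
  by move: mean_G1; rewrite unlock /Rintegral => ->.
have bound0 (x : R) : 0 <= (4 * x ^+ 2 + 2 * V)%:E.
  by rewrite lee_fin addr_ge0// mulr_ge0 ?sqr_ge0// ltW.
rewrite unlock.
apply: (@le_trans _ _ (\int[normal_model sigma G0]_p (4 * p.2 ^+ 2 + 2 * V)%:E)).
  (* Measurability of [posterior_mean sigma G1] is not established, hence this form of
     monotonicity. *)
  apply: ge0_le_integral_nonmeasurable => p; rewrite lee_fin ?sqr_ge0//.
  exact: posterior_mean_sqr_le.
rewrite integral_normal_model//; last first.
  apply/measurable_EFinP; apply: measurable_funD => //.
  by apply: measurable_funM => //; apply: measurable_funX.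
apply: (@le_trans _ _ (\int[G0]_t (4 * (t ^+ 2 + sigma ^+ 2) + 2 * V)%:E)).
  apply: ge0_le_integral_nonmeasurable => t.
    by apply: integral_ge0 => x _; rewrite mule_ge0// lee_fin normal_pdf_ge0.
  by apply: integral_affine_sqr_normal_pdf_le => //; rewrite mulr_ge0// ltW.
under eq_integral do rewrite mulrDr -addrA EFinD EFinM.
have c0 : (0 <= 4 * sigma ^+ 2 + 2 * V)%R.
  by rewrite addr_ge0// mulr_ge0 ?sqr_ge0// ltW.
have mt2 : measurable_fun [set: measurableTypeR R] (fun t => (t ^+ 2)%:E).
  by apply/measurable_EFinP; exact: measurable_funX.
rewrite ge0_integralD//=; last 2 first.
- by move=> t _; rewrite mule_ge0// lee_fin sqr_ge0.
- exact: measurable_funeM.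
rewrite ge0_integralZl//=; last by move=> t _; rewrite lee_fin sqr_ge0.
rewrite integral_cst//= [X in _ + _ * X]probability_setT mule1.
(* The summand [4 * V] bounds four times the second moment of [G0]; the rest is the constant already
   integrated. *)
have -> : (6 * V + 4 * sigma ^+ 2 = 4 * V + (4 * sigma ^+ 2 + 2 * V))%R by ring.
by rewrite [leRHS]EFinD leeD2r// EFinM lee_wpmul2l.
Qed.
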